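(* Let $n\ge1$ and let $M_n$ be the monoid with presentation $\langle \tau_1,\tau_2,\rho \mid \tau_1\rho\tau_2=\rho^2,\ \tau_2\rho^n\tau_1=\rho^{n+1}\rangle$. Then $M_n$ is a Garside monoid with central Garside element $\Delta=\rho^{n+2}$. The corresponding Garside group (the group of fractions of $M_n$) is isomorphic to the dihedral Artin group of type $I_2(4+2n)$ (which is also isomorphic to the complex braid group of $G_{13}$ when $n=1$).
   Context: The Artin group of dihedral type $I_2(4+2n)$ is $\langle \sigma,\tau\mid (\sigma\tau)^{n+2}=(\tau\sigma)^{n+2}\rangle$. The complex braid group of a complex reflection group $W\subset GL(V)$ is the fundamental group of $V^{\mathrm{reg}}/W$, where $V^{\mathrm{reg}}$ is the complement of the reflecting hyperplanes; for the exceptional group $G_{13}$ it is known to have the presentation $\langle x_1,x_2,x_3\mid x_1x_2x_3x_1x_2=x_2x_3x_1x_2x_3,\ x_3x_1x_2x_3=x_1x_2x_3x_1\rangle$. In a monoid $M$, if $ab=c$ then $a$ is a left-divisor of $c$, $b$ a right-divisor of $c$, $c$ a right-multiple of $a$ and a left-multiple of $b$. A right-lcm of two elements is a common right-multiple that left-divides every common right-multiple; a left-gcd is a common left-divisor that is left-divisible by every common left-divisor; left-lcms and right-gcds are defined symmetrically. The divisibility in $M$ is Noetherian if there is $\lambda:M\to\mathbb{Z}_{\ge0}$ with $\lambda(ab)\ge\lambda(a)+\lambda(b)$ for all $a,b$ and $\lambda(a)\ne0$ whenever $a\ne1$. A Garside monoid (with Garside element $\Delta$) is a pair $(M,\Delta)$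 with $M$ a monoid and $\Delta\in M$ such that: (1) $M$ is left- and right-cancellative; (2) the divisibility in $M$ is Noetherian; (3) any two elements of $M$ admit a left- and a right-lcm and a left- and a right-gcd; (4) the sets of left- and right-divisors of $\Delta$ coincide and generate $M$; (5) the set of divisors of $\Delta$ is finite. Such an $M$ embeds in its group of fractions (Ore), which is called its Garside group. *)

(* Defs.v *)
From HB Require Import structures.
From mathcomp Require Import all_boot.
From mathcomp Require Import generic_quotient.
From mathcomp Require Import boolp classical_sets functions cardinality.

Set Implicit Arguments.
Unset Strict Implicit.
Unset Printing Implicit Defensive.

Local Open Scope quotient_scope.
Local Open Scope group_scope.

Inductive word_congr (T : Type) (R : seq T -> seq T -> Prop) :
    seq T -> seq T -> Prop :=
  | WordRel p u v s : R u v -> word_congr R (p ++ u ++ s) (p ++ v ++ s)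
  | WordRefl u : word_congr R u u
  | WordSym u v : word_congr R u v -> word_congr R v u
  | WordTrans u v w : word_congr R u v -> word_congr R v w -> word_congr R u w.

Section PresentedMonoid.
Variables (T : choiceType) (R : seq T -> seq T -> Prop).
Implicit Types u v w : seq T.

Definition word_eqv : rel (seq T) := fun u v => `[< word_congr R u v >].

Fact word_eqv_equiv : equiv_class_of word_eqv.
Proof.
split=> [u | u v | v u w].
- by apply/asboolP; exact: WordRefl.
- by apply/asboolP/asboolP; exact: WordSym.
- by move=> /asboolP uv /asboolP vw; apply/asboolP; exact: WordTrans uv vw.
Qed.

Canonical word_eqv_equiv_rel := EquivRelPack word_eqv_equiv.

Definition presented_monoid := {eq_quot word_eqv}.
HB.instance Definition _ := Choice.on presented_monoid.
HB.instance Definition _ := EqQuotient.on presented_monoid.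

Definition word_class u : presented_monoid := \pi u.

Lemma word_classP u v : word_class u = word_class v <-> word_congr R u v.
Proof.
split=> [/eqquotP/asboolP //|uv].
by apply/eqquotP/asboolP.
Qed.

Lemma word_congr_cat u u' v v' :
  word_congr R u u' -> word_congr R v v' -> word_congr R (u ++ v) (u' ++ v').
Proof.
have catr a b w : word_congr R a b -> word_congr R (a ++ w) (b ++ w).
  elim=> {a b} [p a b s Rab|a|a b _|a b c _ IH1 _ IH2].
  - by rewrite -!catA; exact: WordRel.
  - exact: WordRefl.
  - exact: WordSym.
  - exact: WordTrans IH1 IH2.
have catl a b w : word_congr R a b -> word_congr R (w ++ a) (w ++ b).
  elim=> {a b} [p a b s Rab|a|a b _|a b c _ IH1 _ IH2].
  - by rewrite ![w ++ p ++ _]catA; exact: WordRel.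
  - exact: WordRefl.
  - exact: WordSym.
  - exact: WordTrans IH1 IH2.
by move=> uu' vv'; exact: WordTrans (catr _ _ v uu') (catl _ _ u' vv').
Qed.

Definition presented_mul (x y : presented_monoid) : presented_monoid :=
  word_class (repr x ++ repr y).

Lemma repr_word_class u : word_congr R (repr (word_class u)) u.
Proof. by apply/word_classP; rewrite /word_class reprK. Qed.

Lemma word_class_repr (x : presented_monoid) : word_class (repr x) = x.
Proof. by rewrite /word_class reprK. Qed.

Lemma presented_mulE u v :
  presented_mul (word_class u) (word_class v) = word_class (u ++ v).
Proof. by apply/word_classP/word_congr_cat; exact: repr_word_class. Qed.

Fact presented_mulA : associative presented_mul.
Proof.
move=> x y z; rewrite -[x]word_class_repr -[y]word_class_repr.
by rewrite -[z]word_class_repr !presented_mulE catA.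
Qed.

Fact presented_mul1g : left_id (word_class [::]) presented_mul.
Proof. by move=> x; rewrite -[x]word_class_repr presented_mulE. Qed.

Fact presented_mulg1 : right_id (word_class [::]) presented_mul.
Proof. by move=> x; rewrite -[x]word_class_repr presented_mulE cats0. Qed.

HB.instance Definition _ := isMonoid.Build presented_monoid
  presented_mulA presented_mul1g presented_mulg1.

Definition generator (x : T) : presented_monoid := word_class [:: x].

Lemma word_class_cat u v : word_class (u ++ v) = word_class u * word_class v.
Proof. by rewrite -presented_mulE. Qed.

End PresentedMonoid.

Section PresentedGroup.
Variables (T : choiceType) (R : seq T -> seq T -> Prop).

(** A letter [(x, true)] stands for the generator [x] and [(x, false)] for its
    formal inverse; relations are between positive words, which suffices here. *)
Definition positive_word (u : seq T) : seq (T * bool) :=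
  [seq (x, true) | x <- u].

Inductive group_relation : seq (T * bool) -> seq (T * bool) -> Prop :=
  | GroupRel u v : R u v -> group_relation (positive_word u) (positive_word v)
  | GroupCancel x e : group_relation [:: (x, e); (x, ~~ e)] [::].

Definition presented_group := presented_monoid group_relation.
HB.instance Definition _ := Monoid.on presented_group.

Definition inverse_word (u : seq (T * bool)) : seq (T * bool) :=
  rev [seq (x.1, ~~ x.2) | x <- u].

Lemma inverse_wordK : involutive inverse_word.
Proof.
move=> u; rewrite /inverse_word map_rev revK -map_comp.
by rewrite map_id_in // => -[x e] _ /=; rewrite negbK.
Qed.

Lemma inverse_word_cancel u : word_congr group_relation (inverse_word u ++ u) [::].
Proof.
elim: u => [|[x e] u IHu]; first exact: WordRefl.
rewrite /inverse_word /= rev_cons cat_rcons; apply: WordTrans IHu.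
have := GroupCancel x (~~ e); rewrite negbK.
exact: (@WordRel _ _ (inverse_word u) [:: (x, ~~ e); (x, e)] [::] u).
Qed.

Definition presented_inv (x : presented_group) : presented_group :=
  word_class group_relation (inverse_word (repr x)).

Fact presented_mulVg : left_inverse 1 presented_inv (@mul presented_group).
Proof.
move=> x; rewrite -[X in _ * X](word_class_repr x) /presented_inv.
rewrite -[LHS](@word_class_cat _ group_relation).
by apply/word_classP; exact: inverse_word_cancel.
Qed.

Fact presented_mulgV : right_inverse 1 presented_inv (@mul presented_group).
Proof.
move=> x; rewrite -[X in X * _](word_class_repr x) /presented_inv.
rewrite -[LHS](@word_class_cat _ group_relation).
apply/word_classP; rewrite -{1}[repr x]inverse_wordK.
exact: inverse_word_cancel.
Qed.

HB.instance Definition _ := hasInv.Build presented_group presented_inv.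
HB.instance Definition _ := Monoid_isGroup.Build presented_group
  presented_mulVg presented_mulgV.

End PresentedGroup.

Definition isomorphic_groups (G H : groupType) : Prop :=
  exists f : G -> H, monoid_morphism f /\ bijective f.

Section Divisibility.
Variable M : monoidType.
Implicit Types a b c d m : M.

Definition left_divides a c := exists b, a * b = c.
Definition right_divides b c := exists a, a * b = c.

Definition is_right_lcm a b m :=
  [/\ left_divides a m, left_divides b m &
      forall c, left_divides a c -> left_divides b c -> left_divides m c].

Definition is_left_lcm a b m :=
  [/\ right_divides a m, right_divides b m &
      forall c, right_divides a c -> right_divides b c -> right_divides m c].

Definition is_left_gcd a b d :=
  [/\ left_divides d a, left_divides d b &
      forall c, left_divides c a -> left_divides c b -> left_divides c d].

Definition is_right_gcd a b d :=
  [/\ right_divides d a, right_divides d b &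
      forall c, right_divides c a -> right_divides c b -> right_divides c d].

Definition noetherian_divisibility :=
  exists lambda : M -> nat,
    (forall a b, (lambda a + lambda b <= lambda (a * b)%g)%N) /\
    (forall a, a <> 1 -> lambda a <> 0%N).

Definition left_divisors c : set M := [set a | left_divides a c]%classic.
Definition right_divisors c : set M := [set b | right_divides b c]%classic.

Definition generates_monoid (S : set M) :=
  forall a, exists s : seq M,
    (forall x, x \in s -> S x) /\ a = \prod_(x <- s) x.

Record garside_monoid (Delta : M) : Prop := GarsideMonoid {
  garside_left_cancellative : forall a b c, a * b = a * c -> b = c;
  garside_right_cancellative : forall a b c, b * a = c * a -> b = c;
  garside_noetherian : noetherian_divisibility;
  garside_right_lcm : forall a b, exists m, is_right_lcm a b m;
  garside_left_lcm : forall a b, exists m, is_left_lcm a b m;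
  garside_left_gcd : forall a b, exists d, is_left_gcd a b d;
  garside_right_gcd : forall a b, exists d, is_right_gcd a b d;
  garside_divisors : left_divisors Delta = right_divisors Delta;
  garside_generates : generates_monoid (left_divisors Delta);
  garside_finite : finite_set (left_divisors Delta)
}.

End Divisibility.

(** The embedding [i] makes [G] a group of left and of right fractions of [M];
    by Ore's theorem this determines [G] up to isomorphism. *)
Definition group_of_fractions (M : monoidType) (G : groupType) (i : M -> G) :=
  [/\ monoid_morphism i, injective i,
      forall g, exists a b, g = (i a)^-1 * i b &
      forall g, exists a b, g = i a * (i b)^-1].

Definition tau1 : 'I_3 := @Ordinal 3 0 isT.
Definition tau2 : 'I_3 := @Ordinal 3 1 isT.
Definition rho : 'I_3 := @Ordinal 3 2 isT.

Inductive M_relation (n : nat) : seq 'I_3 -> seq 'I_3 -> Prop :=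
  | M_rel1 : M_relation n [:: tau1; rho; tau2] (nseq 2 rho)
  | M_rel2 : M_relation n (tau2 :: nseq n rho ++ [:: tau1]) (nseq n.+1 rho).

Definition M_ (n : nat) : monoidType := presented_monoid (M_relation n).

Definition M_Delta (n : nat) : M_ n := generator (M_relation n) rho ^+ (n + 2).

Definition sigma_ : 'I_2 := @Ordinal 2 0 isT.
Definition tau_ : 'I_2 := @Ordinal 2 1 isT.

Inductive dihedral_artin_relation (n : nat) : seq 'I_2 -> seq 'I_2 -> Prop :=
  | DihedralArtinRel : dihedral_artin_relation n
      (flatten (nseq (n + 2) [:: sigma_; tau_]))
      (flatten (nseq (n + 2) [:: tau_; sigma_])).

(** The Artin group of type [I_2(4 + 2 n)]. *)
Definition dihedral_artin_group (n : nat) : groupType :=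
  presented_group (dihedral_artin_relation n).

Definition x1 : 'I_3 := @Ordinal 3 0 isT.
Definition x2 : 'I_3 := @Ordinal 3 1 isT.
Definition x3 : 'I_3 := @Ordinal 3 2 isT.

Inductive braid_G13_relation : seq 'I_3 -> seq 'I_3 -> Prop :=
  | BraidG13Rel1 :
      braid_G13_relation [:: x1; x2; x3; x1; x2] [:: x2; x3; x1; x2; x3]
  | BraidG13Rel2 :
      braid_G13_relation [:: x3; x1; x2; x3] [:: x1; x2; x3; x1].

(** The fundamental group of [V^reg / W] for [W] the complex reflection group
    [G_13], given by its known presentation rather than topologically. *)
Definition braid_group_G13 : groupType := presented_group braid_G13_relation.

(* Main.v *)
(** Solving the first relation for [tau2], the group presented by the relations of
    [M_n] is generated by [x = tau1] and [r = rho], the only relation being that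
    [r ^ (n + 2)] is central; with [x = sigma] and [r = sigma tau] this is the
    dihedral Artin group. For [n = 1] the braid group of [G_13] has the same shape,
    with [x = x1] and [r = x1 x2 x3], since [x3 = r x1 r^-1].

    Write [t_1 = tau1], [t_2 = tau2], with gaps [1] and [n], so that the relations
    of [M_n] read [t_s rho^(gap s) t_(~s) = rho^(gap s + 1)]. As [Delta] is central,
    every element has a unique expression [rho^a t_s1 rho^c1 ... t_sk rho^ck] with
    [0 <= c_i < n + 2] and no factor [t_s rho^(gap s) t_(~s)]. Left multiplication
    acts on these normal forms; letting [a] range over the integers the action
    extends to the Artin group, so [M_n] embeds in it and is cancellative.

    The normal forms show that a multiple of [t_s] divisible by [rho] is divisible
    by [t_s rho^(gap s) t_(~s)], and that a common multiple of [tau1] and [tau2] is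
    divisible by [rho]. Left gcds then exist by induction on the additive length
    with [tau1], [tau2] of length 1 and [rho] of length 2; the other lattice
    operations follow since every element divides a power of [Delta]. *)

From HB Require Import structures.
From mathcomp Require Import all_boot all_order all_algebra.
From mathcomp Require Import boolp classical_sets functions cardinality.
From mathcomp Require Import zify.
Require Import Defs.

Set Implicit Arguments.
Unset Strict Implicit.
Unset Printing Implicit Defensive.

Local Open Scope group_scope.

(** * Presented monoids and groups *)

Lemma morphismX (M N : monoidType) (f : M -> N) k a :
  monoid_morphism f -> f (a ^+ k) = f a ^+ k.
Proof.
by move=> [f1 fM]; elim: k => [|k IHk] //; rewrite !expgS fM IHk.
Qed.

Lemma morphismV (G H : groupType) (f : G -> H) a :
  monoid_morphism f -> f a^-1 = (f a)^-1.
Proof. by move=> [f1 fM]; apply/esym/mulg1_eq; rewrite -fM mulgV f1. Qed.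

Section PresentedMonoidTheory.
Variables (T : choiceType) (R : seq T -> seq T -> Prop).

Lemma presented_ind (P : presented_monoid R -> Prop) :
  P 1 -> (forall x a, P a -> P (generator R x * a)) -> forall a, P a.
Proof.
move=> P1 PS a; rewrite -[a]word_class_repr; elim: (repr a) => [|x u IHu] //.
by rewrite -[x :: u]/([:: x] ++ u) word_class_cat; exact: PS.
Qed.

Lemma word_class_prod (u : seq T) :
  word_class R u = \prod_(x <- u) generator R x.
Proof.
elim: u => [|x u IHu]; first by rewrite big_nil.
by rewrite big_cons -IHu -[x :: u]/([:: x] ++ u) word_class_cat.
Qed.

Lemma generator_relation (u v : seq T) :
  R u v -> \prod_(x <- u) generator R x = \prod_(x <- v) generator R x.
Proof.
move=> Ruv; rewrite -!word_class_prod; apply/word_classP.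
by have := WordRel [::] [::] Ruv; rewrite !cats0.
Qed.

Lemma eq_presented_morphism (N : monoidType) (f g : presented_monoid R -> N) :
  monoid_morphism f -> monoid_morphism g ->
  (forall x, f (generator R x) = g (generator R x)) -> f =1 g.
Proof.
move=> [f1 fM] [g1 gM] fg a; elim/presented_ind: a => [|x a IHa].
  by rewrite f1 g1.
by rewrite fM gM fg IHa.
Qed.

Lemma presented_monoid_lift (N : monoidType) (f : T -> N) :
  (forall u v, R u v -> \prod_(x <- u) f x = \prod_(x <- v) f x) ->
  exists F : presented_monoid R -> N,
    monoid_morphism F /\ forall x, F (generator R x) = f x.
Proof.
move=> fR.
have fC u v : word_congr R u v -> \prod_(x <- u) f x = \prod_(x <- v) f x.
  elim=> {u v} [p u v s Ruv|//|//|u v w _ -> _ -> //].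
  by rewrite !big_cat /= (fR u v Ruv).
pose F (a : presented_monoid R) := \prod_(x <- repr a) f x.
have FE u : F (word_class R u) = \prod_(x <- u) f x.
  by apply/fC; exact: repr_word_class.
exists F; split; last by move=> x; rewrite FE big_seq1.
split=> [|a b]; first by rewrite [LHS]FE big_nil.
rewrite -[a]word_class_repr -[b]word_class_repr -word_class_cat !FE.
by rewrite big_cat.
Qed.

End PresentedMonoidTheory.

Section PresentedGroupTheory.
Variables (T : choiceType) (R : seq T -> seq T -> Prop).

Definition group_generator (x : T) : presented_group R :=
  generator (group_relation R) (x, true).

Lemma generator_inverse (x : T) :
  generator (group_relation R) (x, false) = (group_generator x)^-1.
Proof.
apply/esym; apply: (@mulg1_eq (presented_group R)).
have := generator_relation (GroupCancel R x true).
by rewrite !big_cons !big_nil mulg1.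
Qed.

Lemma group_generator_relation (u v : seq T) :
  R u v ->
  \prod_(x <- u) group_generator x = \prod_(x <- v) group_generator x.
Proof.
by move=> /(GroupRel (R := R))/generator_relation; rewrite !big_map.
Qed.

Lemma eq_presented_group_morphism (H : groupType) (f g : presented_group R -> H) :
  monoid_morphism f -> monoid_morphism g ->
  (forall x, f (group_generator x) = g (group_generator x)) -> f =1 g.
Proof.
move=> fm gm fg; apply: (@eq_presented_morphism _ _ H) => // -[x []]; first exact: fg.
rewrite generator_inverse.
by rewrite (morphismV _ fm) (morphismV _ gm) fg.
Qed.

Lemma presented_group_lift (H : groupType) (f : T -> H) :
  (forall u v, R u v -> \prod_(x <- u) f x = \prod_(x <- v) f x) ->
  exists F : presented_group R -> H,
    monoid_morphism F /\ forall x, F (group_generator x) = f x.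
Proof.
move=> fR.
have [|F [Fm FE]] := @presented_monoid_lift _ (group_relation R) H
    (fun x => if x.2 then f x.1 else (f x.1)^-1).
  move=> _ _ [u v /fR|x []]; first by rewrite !big_map.
    by rewrite !big_cons !big_nil /= mulg1 mulgV.
  by rewrite !big_cons !big_nil /= mulg1 mulVg.
by exists F; split=> // x; rewrite FE.
Qed.

End PresentedGroupTheory.

Lemma isomorphic_groups_sym (G H : groupType) :
  isomorphic_groups G H -> isomorphic_groups H G.
Proof.
move=> [f [[f1 fM] [g fK gK]]]; exists g; split; last by exists f.
split=> [|x y]; first by rewrite -f1 fK.
by apply: (can_inj fK); rewrite fM !gK.
Qed.

Lemma bijective_morphism_isomorphic (G H : groupType) (f : G -> H) :
  monoid_morphism f -> injective f -> (forall y, exists x, f x = y) ->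
  isomorphic_groups G H.
Proof.
move=> fm f_inj /choice[g fgK]; exists f; split=> //.
by exists g => // x; apply: f_inj.
Qed.

(** * Lcms and gcds *)

Section LeftDivisibility.
Variable M : monoidType.
Implicit Types a b c : M.

Lemma left_divides_trans b a c :
  left_divides a b -> left_divides b c -> left_divides a c.
Proof. by move=> [u <-] [v <-]; exists (u * v); rewrite mulgA. Qed.

Lemma left_divides_mull a b c :
  left_divides b c -> left_divides (a * b) (a * c).
Proof. by move=> [u <-]; exists u; rewrite mulgA. Qed.

Lemma left_divides_mulr a b : left_divides a (a * b).
Proof. by exists b. Qed.

Lemma left_divides1 a : left_divides 1 a.
Proof. by exists a; rewrite mul1g. Qed.

Lemma left_gcdC a b d : is_left_gcd a b d -> is_left_gcd b a d.
Proof. by case=> da db dmax; split=> // c cb ca; exact: dmax. Qed.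

End LeftDivisibility.

(** * Lcms and right gcds deduced from left gcds and a central element *)

Section CentralGarsideElement.
Variables (M : monoidType) (D : M) (len : M -> nat).
Implicit Types a b c d m u v : M.
Hypothesis mulMI : forall a b c : M, a * b = a * c -> b = c.
Hypothesis mulIM : forall a b c : M, b * a = c * a -> b = c.
Hypothesis lenM : forall a b, len (a * b) = (len a + len b)%N.
Hypothesis len_eq0 : forall a, len a = 0%N -> a = 1.
Hypothesis D_central : forall a, commute D a.
Hypothesis D_multiple : forall a, exists b k, a * b = D ^+ k.
Hypothesis left_gcd : forall a b : M, exists d, is_left_gcd a b d.

Lemma expD_central k a : commute (D ^+ k) a.
Proof. exact/commute_sym/commuteX/commute_sym/D_central. Qed.

Lemma mul_expD_comm a b k : a * b = D ^+ k -> b * a = D ^+ k.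
Proof. by move=> abD; apply: (@mulMI a); rewrite mulgA abD; exact: expD_central. Qed.

Lemma central_divisors k : left_divisors (D ^+ k) = right_divisors (D ^+ k).
Proof.
by apply/seteqP; split=> a [b abD]; exists b; exact: mul_expD_comm.
Qed.

Lemma left_divides_expD a : exists k, forall l, left_divides a (D ^+ (k + l)).
Proof.
have [b [k abD]] := D_multiple a; exists k => l.
by exists (b * D ^+ l); rewrite mulgA abD expgnDr.
Qed.

(** The slack [l] gives two elements that divide different powers of [D] cofactors in one common
    power. *)
Lemma left_dual a k l :
  left_divides a (D ^+ k) -> exists b, b * a = D ^+ (k + l).
Proof.
move=> [b abD]; exists (D ^+ l * b).
by rewrite -mulgA (mul_expD_comm abD) -expgnDr addnC.
Qed.

(* A common multiple of minimal length is least: its gcd with any other common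
   multiple is again a common multiple. *)
Lemma right_lcm a b : exists m, is_right_lcm a b m.
Proof.
pose P k := `[< exists m, [/\ left_divides a m, left_divides b m & len m = k] >].
have exP : exists k, P k.
  have [k ak] := left_divides_expD a; have [l bl] := left_divides_expD b.
  exists (len (D ^+ (k + l))); apply/asboolP; exists (D ^+ (k + l)).
  by split=> //; rewrite addnC.
case: (ex_minnP exP) => _ /asboolP[m [am bm <-]] m_min.
exists m; split=> // c ac bc.
have [d [[u dum] dc dmax]] := left_gcd m c.
have : (len m <= len d)%N.
  by apply: m_min; apply/asboolP; exists d; split=> //; exact: dmax.
rewrite -dum lenM => lenu.
by rewrite (len_eq0 (a := u)) ?mulg1 //; lia.
Qed.

(* If [a * u = D ^+ k] then, as [a] grows, [u] shrinks: right gcds are dual to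
   right lcms. *)
Lemma right_gcd u v : exists d, is_right_gcd u v d.
Proof.
have [k uk] := left_divides_expD u; have [l vl] := left_divides_expD v.
have := uk 0%N; have := vl 0%N; rewrite !addn0 => {}vl {}uk.
have [a auD] := left_dual l uk; have [b] := left_dual k vl.
rewrite addnC; move: (k + l)%N auD => {vl uk} {}k auD bvD.
have [m [am bm mmin]] := right_lcm a b.
have [d mdD] : left_divides m (D ^+ k) by apply: mmin; [exists u|exists v].
have dual_div w e c d' : w * e = D ^+ k -> c * d' = D ^+ k ->
    left_divides w c -> right_divides d' e.
  move=> weD cdD [z wzc]; exists z; apply: (@mulMI w).
  by rewrite mulgA wzc cdD weD.
exists d; split; [exact: dual_div am|exact: dual_div bm|].
move=> c [y ycu] [z zcv].
have ayD : a * y * c = D ^+ k by rewrite -mulgA ycu.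
have : left_divides m (a * y).
  apply: mmin; first exact: left_divides_mulr.
  by exists z; apply: (@mulIM c); rewrite ayD -bvD -zcv mulgA.
exact: dual_div.
Qed.

(** Mirror of [right_lcm]: a common left-multiple of least length is compared with any other through
    their right gcd, again a common left-multiple. *)
Lemma left_lcm a b : exists m, is_left_lcm a b m.
Proof.
pose P k := `[< exists m, [/\ right_divides a m, right_divides b m & len m = k] >].
have exP : exists k, P k.
  have [k ak] := left_divides_expD a; have [l bl] := left_divides_expD b.
  exists (len (D ^+ (k + l))); apply/asboolP; exists (D ^+ (k + l)).
  have [x axD] := ak l; have [y byD] := bl k.
  by split=> //; [exists x|exists y; rewrite addnC]; exact: mul_expD_comm.
case: (ex_minnP exP) => _ /asboolP[m [am bm <-]] m_min.
exists m; split=> // c ac bc.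
have [d [[u udm] dc dmax]] := right_gcd m c.
have : (len m <= len d)%N.
  by apply: m_min; apply/asboolP; exists d; split=> //; exact: dmax.
rewrite -udm lenM => lenu.
by rewrite (len_eq0 (a := u)) ?mul1g //; lia.
Qed.

End CentralGarsideElement.

(** * Left gcds by induction on length *)

Section LeftGcd.
Variables (M : monoidType) (t : bool -> M) (r : M) (gap : bool -> nat).
Variable len : M -> nat.
Implicit Types a b c d g : M.
Hypothesis mulMI : forall a b c : M, a * b = a * c -> b = c.
Hypothesis lenM : forall a b, len (a * b) = (len a + len b)%N.
Hypothesis len_t : forall s, (0 < len (t s))%N.
Hypothesis len_r : (0 < len r)%N.
Hypothesis t_rel : forall s, t s * r ^+ gap s * t (~~ s) = r ^+ (gap s).+1.
Hypothesis atomP : forall a,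
  [\/ a = 1, exists b, a = r * b | exists s b, a = t s * b].
Hypothesis r_div_t : forall s a,
  left_divides r (t s * a) -> left_divides (r ^+ gap s * t (~~ s)) a.
Hypothesis t_div_t : forall s a b, t s * a = t (~~ s) * b -> left_divides r (t s * a).

(** A common divisor starting with [r] cancels down to [a] and [b]. For one starting with [t s], the
    gcd of the cofactors of [t s] is used: [t s] times it is divisible by [r] and so falls under the
    first case. *)
Lemma left_gcd_r a b g :
  is_left_gcd a b g ->
  (forall s c d, r * a = t s * c -> r * b = t s * d -> exists g', is_left_gcd c d g') ->
  is_left_gcd (r * a) (r * b) (r * g).
Proof.
move=> [ga gb gmax] gcd_t; split; try exact: left_divides_mull.
move=> c; case: (atomP c) => [->|[c' ->]|[s [c' ->]]] ca cb.
- exact: left_divides1.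
- apply: left_divides_mull; apply: gmax.
    by case: ca => u; rewrite -mulgA => /mulMI <-; exists u.
  by case: cb => u; rewrite -mulgA => /mulMI <-; exists u.
case: ca cb => [u]; rewrite -mulgA => ua [v]; rewrite -mulgA => vb.
have /r_div_t[a' cua'] : left_divides r (t s * (c' * u)) by exists a.
have /r_div_t[b' cvb'] : left_divides r (t s * (c' * v)) by exists b.
have [h [hu hv hmax]] := gcd_t s (c' * u) (c' * v) (esym ua) (esym vb).
have [g2 hE] : left_divides (r ^+ gap s * t (~~ s)) h.
  by apply: hmax; [rewrite -cua'|rewrite -cvb']; exact: left_divides_mulr.
(* The relation turns the prefix [t s * r ^+ gap s * t (~~ s)] into a power of [r], from which one
   [r] is split off. *)
have thE : t s * h = r * (r ^+ gap s * g2).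
  by rewrite -hE !mulgA t_rel expgS.
have g2g : left_divides (r ^+ gap s * g2) g.
  apply: gmax.
    have := left_divides_mull (t s) hu; rewrite ua thE => -[w].
    by rewrite -mulgA => /mulMI <-; exists w.
  have := left_divides_mull (t s) hv; rewrite vb thE => -[w].
  by rewrite -mulgA => /mulMI <-; exists w.
apply: (@left_divides_trans _ (t s * h)); last by rewrite thE; exact: left_divides_mull.
by apply/left_divides_mull/hmax; exact: left_divides_mulr.
Qed.

(** A nontrivial common divisor must start with [t s]: starting with [r] is excluded outright, and
    starting with [t (~~ s)] would force [r] by [t_div_t]. *)
Lemma left_gcd_t s a b g :
  ~ left_divides r (t s * a) -> is_left_gcd a b g ->
  is_left_gcd (t s * a) (t s * b) (t s * g).
Proof.
move=> ra [ga gb gmax]; split; try exact: left_divides_mull.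
move=> c; case: (atomP c) => [->|[c' ->]|[s' [c' ->]]] ca cb.
- exact: left_divides1.
- by case: ra; apply: left_divides_trans ca; exact: left_divides_mulr.
have [ss'|/eqP ss'] := eqVneq s' s.
  subst s'; apply: left_divides_mull; apply: gmax.
    by case: ca => u; rewrite -mulgA => /mulMI <-; exists u.
  by case: cb => u; rewrite -mulgA => /mulMI <-; exists u.
case: ra; case: ca => u; rewrite -mulgA => /esym ua.
have s'E : s' = ~~ s by case: (s) (s') ss' => -[].
by apply: (t_div_t (b := c' * u)); rewrite ua s'E.
Qed.

Lemma left_gcd_t1 s a b :
  ~ left_divides r (t s * a) -> ~ left_divides (t s) b ->
  is_left_gcd (t s * a) b 1.
Proof.
move=> ra tb; split; try exact: left_divides1.
move=> c; case: (atomP c) => [->|[c' ->]|[s' [c' ->]]] ca cb.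
- exact: left_divides1.
- by case: ra; apply: left_divides_trans ca; exact: left_divides_mulr.
have [ss'|/eqP ss'] := eqVneq s' s.
  by case: tb; rewrite -ss'; apply: left_divides_trans cb; exact: left_divides_mulr.
case: ra; case: ca => u; rewrite -mulgA => /esym ua.
have s'E : s' = ~~ s by case: (s) (s') ss' => -[].
by apply: (t_div_t (b := c' * u)); rewrite ua s'E.
Qed.

Lemma left_gcd_exists a b : exists d, is_left_gcd a b d.
Proof.
have [k lek] := ubnP (len a + len b); elim: k a b lek => // k IHk a b lek.
have no_r x y : (len x + len y < k.+1)%N -> ~ left_divides r x ->
    exists d, is_left_gcd x y d.
  case: (atomP x) => [->|[x' ->]|[s [x' ->]]] lexy rx.
  - by exists 1; split; try exact: left_divides1.
  - by case: rx; exact: left_divides_mulr.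
  have [[y' yE]|ty] := pselect (left_divides (t s) y).
    have [|g gP] := IHk x' y'.
      by move: lexy (len_t s); rewrite -yE !lenM; lia.
    by exists (t s * g); rewrite -yE; exact: left_gcd_t.
  by exists 1; exact: left_gcd_t1.
have [[a' aE]|ra] := pselect (left_divides r a); last exact: no_r.
have [[b' bE]|rb] := pselect (left_divides r b); last first.
  by have [|d /left_gcdC dP] := no_r b a _ rb; [rewrite addnC|exists d].
rewrite -{}aE -{}bE !lenM in lek *.
have [|g gP] := IHk a' b'; first by lia.
(* The auxiliary pair [c], [d] is covered by induction since [t s] has positive length. *)
exists (r * g); apply: left_gcd_r => // s c d acE bdE.
apply: IHk; move: lek (len_t s).
by rewrite -!lenM acE bdE !lenM; lia.
Qed.

End LeftGcd.

(** * Normal forms *)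

(** Self-maps under composition. Only a monoid is needed as target of the action; inverses are
    exhibited by hand when it is extended to the Artin group. *)
Definition endo (Y : Type) := Y -> Y.

HB.instance Definition _ (Y : Type) := gen_eqMixin (endo Y).
HB.instance Definition _ (Y : Type) := gen_choiceMixin (endo Y).

Section EndoMonoid.
Variable Y : Type.

Definition endo_mul (f g : endo Y) : endo Y := fun y => f (g y).

Fact endo_mulA : associative endo_mul. Proof. by []. Qed.
Fact endo_mul1g : left_id (id : endo Y) endo_mul. Proof. by []. Qed.
Fact endo_mulg1 : right_id (id : endo Y) endo_mul. Proof. by []. Qed.

HB.instance Definition _ := isMonoid.Build (endo Y)
  endo_mulA endo_mul1g endo_mulg1.

Lemma endoM (f g : endo Y) y : (f * g) y = f (g y). Proof. by []. Qed.

Lemma endo1 y : (1 : endo Y) y = y. Proof. by []. Qed.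

End EndoMonoid.

Section NormalForm.
Variable n : nat.

Definition gap (s : bool) : nat := if s then 1%N else n.

Lemma gapD s : (gap s + gap (~~ s))%N = n.+1.
Proof. by case: s; rewrite /gap /= ?addn1. Qed.

Lemma gap_lt s : (gap s < n + 2)%N.
Proof. by case: s => /=; lia. Qed.

(* The state [(a, [:: (s1, c1); ...; (sk, ck)])] stands for
   [rho ^ a * t_s1 * rho ^ c1 * ... * t_sk * rho ^ ck], where [t_true] and
   [t_false] are [tau1] and [tau2]. *)
Definition state : Type := int * seq (bool * nat).

(** Detects the forbidden factor [t_s rho^(gap s) t_(~s)] at the front of [t_s rho^c] followed by
    [l]. *)
Definition cancels (s : bool) (c : nat) (l : seq (bool * nat)) : bool :=
  if l is (s', _) :: _ then (c == gap s) && (s' == ~~ s) else false.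

Fixpoint reduced (l : seq (bool * nat)) : bool :=
  if l is (s, c) :: l' then [&& (c < n + 2)%N, ~~ cancels s c l' & reduced l']
  else true.

(** Left multiplication by [t_s]: it passes the central power [rho^(a - b)] and meets [rho^b]. A
    forbidden factor becomes [rho^(b + 1)] and merges with the next exponent. The default of [head]
    is never reached, as [cancels] forces a nonempty list. *)
Definition step (s : bool) (x : state) : state :=
  let b := `|(x.1 %% (n + 2)%:Z%R)%Z|%N in
  if cancels s b x.2 then ((x.1 + 1%:Z + (head (s, 0%N) x.2).2%:Z)%R, behead x.2)
  else ((x.1 - b%:Z)%R, (s, b) :: x.2).

Lemma stepE s (q : int) (b : nat) l : (b < n + 2)%N ->
  step s ((q * (n + 2)%:Z + b%:Z)%R, l) =
  if cancels s b l
  then ((q * (n + 2)%:Z + b%:Z + 1%:Z + (head (s, 0%N) l).2%:Z)%R, behead l)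
  else ((q * (n + 2)%:Z)%R, (s, b) :: l).
Proof.
move=> bn; rewrite /step /=.
have -> : ((q * (n + 2)%:Z + b%:Z)%R %% (n + 2)%:Z%R)%Z = b%:Z%R.
  by rewrite intdiv.modzMDl intdiv.modz_small //; lia.
by rewrite absz_nat GRing.addrK.
Qed.

Lemma int_euclid (a : int) :
  exists (q : int) (b : nat), (b < n + 2)%N /\ a = (q * (n + 2)%:Z + b%:Z)%R.
Proof.
exists (a %/ (n + 2)%:Z%R)%Z, `|(a %% (n + 2)%:Z%R)%Z|%N; split; last first.
  rewrite {1}[a](intdiv.divz_eq a (n + 2)%:Z%R) gez0_abs //.
  by rewrite intdiv.modz_ge0 //; lia.
have := intdiv.modz_ge0 a (d := (n + 2)%:Z%R); have := @intdiv.ltz_pmod a (n + 2)%:Z%R.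
by lia.
Qed.

Lemma step_reduced s x : reduced x.2 -> reduced (step s x).2.
Proof.
case: x => a l /= rl; have [q [b [bn ->]]] := int_euclid a.
rewrite stepE //; case: ifP => [|nc] /=; last by rewrite bn nc.
by case: l rl => //= -[s' c] l /and3P[].
Qed.

Definition normal_form : Type := {x : state | reduced x.2}.

Definition nf_rho : endo normal_form :=
  fun y => Sub ((val y).1 + 1%:Z, (val y).2)%R (valP y).

Definition nf_tau s : endo normal_form :=
  fun y => Sub (step s (val y)) (step_reduced s (valP y)).

Lemma val_nf_rhoX k y :
  val ((nf_rho ^+ k) y) = (((val y).1 + k%:Z)%R, (val y).2).
Proof.
elim: k y => [|k IHk] y; first by rewrite expg0 endo1 GRing.addr0; case: (val y).
rewrite expgS endoM [LHS]/= IHk /=; congr pair; lia.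
Qed.

Lemma nf_tau_rel s :
  nf_tau s * nf_rho ^+ gap s * nf_tau (~~ s) = nf_rho ^+ (gap s).+1.
Proof.
apply/funext => y; apply: val_inj; rewrite val_nf_rhoX !endoM.
rewrite -[LHS]/(step s (val _)) val_nf_rhoX.
rewrite -[val (nf_tau _ y)]/(step (~~ s) (val y)).
case: y => -[a l] /= rl; have [q [b [bn ->]]] := int_euclid a.
rewrite stepE //; case: ifP => [|nc] /=; last first.
  (* The inner step pushed [~~ s], so the outer one finds residue [gap s] and cancels it. *)
  rewrite stepE ?gap_lt //= !eqxx /=; congr pair; lia.
case: l rl => //= -[s' c] l /and3P[cn cc rl] /andP[/eqP bE /eqP s'E].
rewrite negbK in s'E; subst s'.
(* The inner step removed [(s, c)]. The gaps sum to [n + 1], so the residue is [c] again, and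
   reducedness makes the outer step restore the pair. *)
have -> : (q * (n + 2)%:Z + b%:Z + 1%:Z + c%:Z + (gap s)%:Z =
           (q + 1%:Z) * (n + 2)%:Z + c%:Z)%R.
  by have := gapD s; rewrite bE; lia.
rewrite stepE // (negbTE cc); congr pair.
by have := gapD s; rewrite bE; lia.
Qed.

End NormalForm.

(** * The monoid [M_ n] *)

Section MonoidM.
Variable n : nat.
Let M := M_ n.

Definition M_tau (s : bool) : M :=
  generator (M_relation n) (if s then tau1 else tau2).

Definition M_rho : M := generator (M_relation n) rho.

Lemma prod_nseq_generator (N : monoidType) (f : 'I_3 -> N) k (x : 'I_3) :
  \prod_(y <- nseq k x) f y = f x ^+ k.
Proof.
elim: k => [|k IHk]; first by rewrite big_nil.
by rewrite big_cons IHk expgS.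
Qed.

Lemma M_tau_rel s :
  M_tau s * M_rho ^+ gap n s * M_tau (~~ s) = M_rho ^+ (gap n s).+1.
Proof.
case: s.
  have := generator_relation (M_rel1 n).
  by rewrite !big_cons !big_nil !mulg1 mulgA.
have := generator_relation (M_rel2 n).
by rewrite big_cons big_cat big_seq1 !prod_nseq_generator mulgA.
Qed.

Lemma M_lift (N : monoidType) (t : bool -> N) (r : N) :
  (forall s, t s * r ^+ gap n s * t (~~ s) = r ^+ (gap n s).+1) ->
  exists F : M -> N,
    [/\ monoid_morphism F, forall s, F (M_tau s) = t s & F M_rho = r].
Proof.
move=> t_rel.
pose f (i : 'I_3) := if i == tau1 then t true else if i == tau2 then t false else r.
have [|F [Fm FE]] := @presented_monoid_lift _ (M_relation n) N f.
  move=> _ _ [|].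
    by rewrite !big_cons !big_nil !mulg1 mulgA; exact: (t_rel true).
  rewrite big_cons big_cat big_seq1 !prod_nseq_generator mulgA.
  exact: (t_rel false).
by exists F; split=> // [[]|]; rewrite FE.
Qed.

Lemma M_generatorP (P : M -> Prop) :
  P M_rho -> (forall s, P (M_tau s)) ->
  forall i, P (generator (M_relation n) i).
Proof.
move=> Pr Pt [[|[|[|//]]] i3].
- by have := Pt true; congr (P (generator _ _)); exact: val_inj.
- by have := Pt false; congr (P (generator _ _)); exact: val_inj.
- by move: Pr; congr (P (generator _ _)); exact: val_inj.
Qed.

Lemma M_ind (P : M -> Prop) :
  P 1 -> (forall a, P a -> P (M_rho * a)) ->
  (forall s a, P a -> P (M_tau s * a)) -> forall a, P a.
Proof.
move=> P1 Pr Pt; apply: presented_ind => // i a Pa; move: i.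
by apply: (@M_generatorP (fun g => P (g * a))) => [|s]; [exact: Pr|exact: Pt].
Qed.

Lemma M_atomP (a : M) :
  [\/ a = 1, exists b, a = M_rho * b | exists s b, a = M_tau s * b].
Proof.
elim/M_ind: a => [|a _|s a _]; first by constructor 1.
  by constructor 2; exists a.
by constructor 3; exists s, a.
Qed.

Lemma eq_M_morphism (N : monoidType) (f g : M -> N) :
  monoid_morphism f -> monoid_morphism g ->
  (forall s, f (M_tau s) = g (M_tau s)) -> f M_rho = g M_rho -> f =1 g.
Proof.
move=> [f1 fM] [g1 gM] fgt fgr; elim/M_ind => [|a|s a]; first by rewrite f1 g1.
  by rewrite fM gM fgr => ->.
by rewrite fM gM fgt => ->.
Qed.

Lemma M_tau_dual s : 
  M_tau s * (M_rho ^+ gap n s * M_tau (~~ s) * M_rho ^+ gap n (~~ s)) = M_Delta n.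
Proof.
rewrite !mulgA M_tau_rel -expgnDr; congr (_ ^+ _).
by have := gapD n s; lia.
Qed.

Lemma M_DeltaE s :
  (M_rho ^+ gap n s * M_tau (~~ s)) * (M_rho ^+ gap n (~~ s) * M_tau s) = M_Delta n.
Proof.
have := M_tau_rel (~~ s); rewrite negbK => t_rel.
rewrite mulgA -2!(mulgA (M_rho ^+ _)) t_rel -expgnDr; congr (_ ^+ _).
by have := gapD n s; lia.
Qed.

(** The two factorizations above read [Delta = t_s u = u t_s] with the same [u], so
    [Delta t_s = t_s u t_s = t_s Delta]. *)
Lemma M_Delta_central (a : M) : commute (M_Delta n) a.
Proof.
elim/M_ind: a => [|a IHa|s a IHa]; first exact: commute1.
  apply: commuteM => //; apply/commute_sym/commuteX; exact: commute_refl.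
apply: commuteM => //; rewrite /commute -[in RHS](M_DeltaE s) -(M_tau_dual s).
by rewrite !mulgA.
Qed.

Lemma M_Delta_multiple (a : M) : exists b k, a * b = M_Delta n ^+ k.
Proof.
have dual (g a' g' : M) : g * g' = M_Delta n ->
    (exists b k, a' * b = M_Delta n ^+ k) ->
    exists b k, g * a' * b = M_Delta n ^+ k.
  move=> gg' [b [k abD]]; exists (b * g'), k.+1.
  rewrite !mulgA -(mulgA g) abD.
  rewrite -(expD_central M_Delta_central) -mulgA gg'.
  by rewrite expgSr.
elim/M_ind: a => [|a IHa|s a IHa].
- by exists 1, 0%N; rewrite mulg1.
- by apply: (dual _ _ (M_rho ^+ n.+1)) IHa; rewrite -expgS /M_Delta addn2.
- exact: dual (M_tau_dual s) IHa.
Qed.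

(** * The faithful action on normal forms and the divisibility it reveals *)

Fact M_act_exists : exists A : M -> endo (normal_form n),
  [/\ monoid_morphism A, forall s, A (M_tau s) = nf_tau s & A M_rho = @nf_rho n].
Proof. exact/M_lift/nf_tau_rel. Qed.

Definition M_act : M -> endo (normal_form n) := sval (cid M_act_exists).

Lemma M_act_morphism : monoid_morphism M_act.
Proof. by rewrite /M_act; case: cid => A []. Qed.

Lemma M_act_tau s : M_act (M_tau s) = nf_tau s.
Proof. by rewrite /M_act; case: cid => A []. Qed.

Lemma M_act_rho : M_act M_rho = @nf_rho n.
Proof. by rewrite /M_act; case: cid => A []. Qed.

Definition M_nf (a : M) : state := val (M_act a (exist _ (0%R, [::]) isT)).

Lemma M_nf_tau s a : M_nf (M_tau s * a) = step n s (M_nf a).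
Proof. by rewrite /M_nf M_act_morphism M_act_tau. Qed.

Lemma M_nf_rho a : M_nf (M_rho * a) = ((M_nf a).1 + 1%:Z, (M_nf a).2)%R.
Proof. by rewrite /M_nf M_act_morphism M_act_rho. Qed.

(** Evaluation of a state in the monoid; the absolute value makes it meaningful only for a
    nonnegative leading exponent. *)
Definition M_word (x : state) : M :=
  M_rho ^+ `|x.1| * \prod_(p <- x.2) (M_tau p.1 * M_rho ^+ p.2).

Lemma M_rhoX_split (q b : nat) :
  M_rho ^+ (q * (n + 2) + b) = M_rho ^+ b * M_Delta n ^+ q :> M.
Proof. by rewrite addnC expgnDr mulnC expgnA. Qed.

Lemma M_word_split (q b : nat) l :
  M_word ((q%:Z * (n + 2)%:Z + b%:Z)%R, l) = M_Delta n ^+ q * M_word (b%:Z%R, l).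
Proof.
rewrite /M_word /=.
rewrite M_rhoX_split mulgA; congr (_ * _).
exact/commute_sym/(expD_central M_Delta_central).
Qed.

Lemma nat_euclid (a : int) : (0 <= a)%R ->
  exists q b : nat, (b < n + 2)%N /\ a = (q%:Z * (n + 2)%:Z + b%:Z)%R.
Proof.
case: a => // a _; exists (a %/ (n + 2))%N, (a %% (n + 2))%N.
rewrite ltn_mod; split; first by lia.
by rewrite {1}(divn_eq a (n + 2)); lia.
Qed.

(** After [Delta ^ q] is moved aside by centrality, the cancelling case is a defining relation.
    Hence evaluating the normal form of [a] gives back [a]. *)
Lemma M_word_step s x : (0 <= x.1)%R ->
  (0 <= (step n s x).1)%R /\ M_word (step n s x) = M_tau s * M_word x.
Proof.
case: x => a l /= /nat_euclid[q [b [bn ->]]]; rewrite stepE //.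
rewrite M_word_split mulgA -(expD_central M_Delta_central) -mulgA.
case: ifP => [|_]; last first.
  split=> /=; first by lia.
  rewrite -[X in M_word (X, _)]GRing.addr0 M_word_split /M_word /=.
  by rewrite big_cons expg0 mul1g !mulgA.
case: l => //= -[s' c] l /andP[/eqP-> /eqP->] /=; split; first by lia.
rewrite -!GRing.addrA M_word_split; congr (_ * _).
rewrite /M_word /= big_cons /=.
by rewrite addnA addn1 expgnDr -M_tau_rel !mulgA.
Qed.

Lemma M_nfP a : (0 <= (M_nf a).1)%R /\ M_word (M_nf a) = a.
Proof.
elim/M_ind: a => [|a [a0 aE]|s a [a0 aE]].
- by rewrite /M_nf M_act_morphism; split; rewrite // /M_word big_nil mulg1.
- rewrite M_nf_rho; split=> /=; first by lia.
  rewrite -[in RHS]aE /M_word /= mulgA -expgS.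
  by have -> : `|((M_nf a).1 + 1%:Z)%R|%N = `|(M_nf a).1|.+1 by lia.
- by rewrite M_nf_tau; have [] := M_word_step s a0; rewrite aE.
Qed.

Lemma M_act_inj : injective M_act.
Proof.
by move=> a b ab; rewrite -(M_nfP a).2 -(M_nfP b).2 /M_nf ab.
Qed.

Lemma rho_divides_nf a : left_divides M_rho a <-> (0 < (M_nf a).1)%R.
Proof.
split=> [[b <-]|a0]; first by rewrite M_nf_rho /=; have := (M_nfP b).1; lia.
rewrite -(M_nfP a).2; exists (M_word ((M_nf a).1 - 1%:Z, (M_nf a).2)%R).
rewrite /M_word /= mulgA -expgS; congr (_ ^+ _ * _); lia.
Qed.

(** The leading exponent after the step is positive for one of two reasons: the step cancelled, so
    the factor is visible in [a], or [q > 0], and then [Delta], which starts with the factor,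
    divides [a]. *)
Lemma rho_divides_tau s a :
  left_divides M_rho (M_tau s * a) ->
  left_divides (M_rho ^+ gap n s * M_tau (~~ s)) a.
Proof.
move/rho_divides_nf; rewrite M_nf_tau -{2}(M_nfP a).2; have := (M_nfP a).1.
case: (M_nf a) => x l /= /nat_euclid[q [b [bn ->]]].
rewrite stepE // M_word_split; case: ifP => [|_ /=].
  case: l => //= -[s' c] l /andP[/eqP-> /eqP->] _.
  rewrite (expD_central M_Delta_central) /M_word /= big_cons /=.
  rewrite -!mulgA mulgA; exact: left_divides_mulr.
case: q => [|q] q0; first by exfalso; lia.
rewrite expgS -(M_DeltaE s) -!mulgA mulgA; exact: left_divides_mulr.
Qed.

Lemma tau_divides_tau s a b :
  M_tau s * a = M_tau (~~ s) * b -> left_divides M_rho (M_tau s * a).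
Proof.
(* Without divisibility by [rho] the step pushes, so the first letter of the normal form is [s'];
   equal elements cannot start with both [s] and [~~ s]. *)
have head_step s' c : ~ left_divides M_rho (M_tau s' * c) ->
    ohead [seq p.1 | p <- (step n s' (M_nf c)).2] = Some s'.
  move/rho_divides_nf; rewrite M_nf_tau; have := (M_nfP c).1.
  case: (M_nf c) => x l /= /nat_euclid[q [k [kn ->]]].
  rewrite stepE //; case: ifP => // _ /=; lia.
move=> ab; apply: contrapT => ra.
have := head_step _ _ ra; rewrite -M_nf_tau ab M_nf_tau.
rewrite head_step; first by case: (s).
by rewrite -ab.
Qed.

(** * Additive length and finiteness of divisors *)

Definition letter_weight (i : 'I_3) : nat := (if i == rho then 2 else 1)%N.

Definition M_len (a : M) : nat := (\sum_(i <- repr a) letter_weight i)%N.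

(** Both relations are homogeneous for these weights: [1 + 2 + 1 = 2 * 2] and
    [1 + 2 n + 1 = 2 (n + 1)]. *)
Lemma M_len_word u :
  M_len (word_class (M_relation n) u) = (\sum_(i <- u) letter_weight i)%N.
Proof.
have nseqE k x : (\sum_(i <- nseq k x) letter_weight i = k * letter_weight x)%N.
  by rewrite big_nseq iter_addn_0 mulnC.
suff wC u1 u2 : word_congr (M_relation n) u1 u2 ->
    (\sum_(i <- u1) letter_weight i = \sum_(i <- u2) letter_weight i)%N.
  exact/wC/repr_word_class.
elim=> {u1 u2} [p u1 u2 s R|//|//|u1 u2 u3 _ -> _ -> //].
rewrite !big_cat /=; congr (_ + (_ + _))%N.
case: {u1 u2} R; first by rewrite !big_cons !big_nil.
by rewrite big_cons big_cat big_seq1 !nseqE /letter_weight /=; lia.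
Qed.

Lemma M_lenM a b : M_len (a * b) = (M_len a + M_len b)%N.
Proof.
rewrite -[a]word_class_repr -[b]word_class_repr -word_class_cat !M_len_word.
by rewrite big_cat.
Qed.

Lemma size_repr_le_len a : (size (repr a) <= M_len a)%N.
Proof.
rewrite /M_len -sum1_size leq_sum // => i _.
by rewrite /letter_weight; case: ifP.
Qed.

Lemma M_len_eq0 a : M_len a = 0%N -> a = 1.
Proof.
move=> a0; have := size_repr_le_len a; rewrite a0 leqn0 size_eq0 => /eqP aE.
by rewrite -[a]word_class_repr aE.
Qed.

Lemma M_len_tau s : M_len (M_tau s) = 1%N.
Proof. by rewrite M_len_word big_seq1; case: s. Qed.

Lemma M_len_rho : M_len M_rho = 2%N.
Proof. by rewrite M_len_word big_seq1. Qed.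

Lemma M_finite_divisors (a : M) : finite_set (left_divisors a).
Proof.
pose f (u : {bseq (M_len a) of 'I_3}) : M := word_class (M_relation n) u.
apply: (@sub_finite_set _ _ (f @` [set: {bseq (M_len a) of 'I_3}])%classic);
  last exact/finite_image/finite_finset.
move=> b [c bcE]; have sb : (size (repr b) <= M_len a)%N.
  by have := size_repr_le_len b; rewrite -bcE M_lenM; lia.
by exists (Bseq sb) => //; exact: word_class_repr.
Qed.

Lemma M_generates : generates_monoid (left_divisors (M_Delta n)).
Proof.
move=> a; exists [seq generator (M_relation n) x | x <- repr a]; split.
  move=> _ /mapP[i _ ->]; move: i; apply: M_generatorP => [|s].
    by exists (M_rho ^+ n.+1); rewrite -expgS /M_Delta addn2.
  by rewrite /left_divisors /= -(M_tau_dual s); exact: left_divides_mulr.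
by rewrite big_map -word_class_prod word_class_repr.
Qed.

End MonoidM.

(** * The dihedral Artin group as group of fractions *)

Lemma commute_two_sided_inverse (N : monoidType) (a b x : N) :
  a * b = 1 -> b * a = 1 -> commute x a -> commute x b.
Proof.
move=> ab ba xa; rewrite /commute -[x * b]mul1g -ba -!mulgA (mulgA a) -xa.
by rewrite -mulgA ab mulg1.
Qed.

Lemma expg_right_inverse (N : monoidType) (a b : N) k :
  a * b = 1 -> b * a = 1 -> a ^+ k * b ^+ k = 1.
Proof. by move=> ab ba; rewrite -expgMn ?ab ?expg1n // /commute ab ba. Qed.

Lemma left_inverse_cancel (N : monoidType) (x x' r r' a b : N) :
  x' * x = 1 -> r' * r = 1 -> x * r * a = x * r * b -> a = b.
Proof.
move=> x'x r'r /(congr1 (fun z => r' * (x' * z))).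
by rewrite -!mulgA !(mulgA x') x'x !mul1g !(mulgA r') r'r !mul1g.
Qed.

Lemma conj_inverseX (N : monoidType) (x x' r : N) k :
  x * x' = 1 -> x' * x = 1 -> (x' * r * x) ^+ k = x' * r ^+ k * x.
Proof.
move=> xx' x'x; elim: k => [|k IHk]; first by rewrite mulg1 x'x.
by rewrite !expgS IHk !mulgA -(mulgA (x' * r) x) xx' mulg1.
Qed.

(** With [v = r^-1]: [r t r^-2 s = r t r^k r^-(k+2) s = r (t r^k s) r^-(k+2) = 1]. *)
Lemma left_inverse_of_rel (N : monoidType) (s t r v : N) k :
  r * v = 1 -> v * r = 1 -> commute s (r ^+ (k + 2)) ->
  t * r ^+ k * s = r ^+ k.+1 -> r * t * v ^+ 2 * s = 1.
Proof.
move=> rv vr sr trs; have rvX := expg_right_inverse _ rv vr.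
have -> : v ^+ 2 = r ^+ k * v ^+ (k + 2) by rewrite expgnDr mulgA rvX mul1g.
have sv := commute_two_sided_inverse (rvX _) (expg_right_inverse _ vr rv) sr.
rewrite -!mulgA -sv !mulgA -2!(mulgA r) trs -expgS -[k.+2]addn2.
exact: rvX.
Qed.

Section DihedralArtinGroup.
Variable n : nat.
Let D := dihedral_artin_group n.

Lemma prod_flatten_nseq (T : Type) (N : monoidType) (f : T -> N) k x y :
  \prod_(z <- flatten (nseq k [:: x; y])) f z = (f x * f y) ^+ k.
Proof.
elim: k => [|k IHk]; first by rewrite big_nil.
by rewrite /= !big_cons IHk expgS mulgA.
Qed.

Definition D_sigma : D := group_generator (dihedral_artin_relation n) sigma_.
Definition D_rho : D :=
  D_sigma * group_generator (dihedral_artin_relation n) tau_.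

Lemma D_tauE : group_generator (dihedral_artin_relation n) tau_ = D_sigma^-1 * D_rho.
Proof. by rewrite /D_rho mulKg. Qed.

(** Since [tau sigma] is the conjugate of [rho = sigma tau] by [sigma], the defining relation says
    that this conjugation fixes [rho^(n+2)]. *)
Lemma D_commute : commute D_sigma (D_rho ^+ (n + 2)).
Proof.
have := group_generator_relation (DihedralArtinRel n).
rewrite !prod_flatten_nseq -/D_sigma -/D_rho D_tauE -mulgA -conjgE -conjXg.
by move/esym/conjg_fixP/commgP/commute_sym.
Qed.

(** The target is a monoid with explicit inverses so that [endo] qualifies; [tau] goes to
    [x' * r]. *)
Lemma dihedral_lift (N : monoidType) (x x' r r' : N) :
  x * x' = 1 -> x' * x = 1 -> r * r' = 1 -> r' * r = 1 ->
  commute x (r ^+ (n + 2)) ->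
  exists F : D -> N, [/\ monoid_morphism F, F D_sigma = x & F D_rho = r].
Proof.
move=> xx' x'x rr' r'r xr; pose f (y : 'I_2 * bool) :=
  if y.1 == sigma_ then (if y.2 then x else x') else (if y.2 then x' * r else r' * x).
have xK z : x * (x' * z) = z by rewrite mulgA xx' mul1g.
have rK z : r * (r' * z) = z by rewrite mulgA rr' mul1g.
have [|F [Fm FE]] :=
    @presented_monoid_lift _ (group_relation (dihedral_artin_relation n)) N f.
  move=> _ _ [_ _ []|[i i2] []].
  - rewrite !big_map !prod_flatten_nseq /f /= xK.
    by rewrite (conj_inverseX _ _ xx' x'x) -mulgA -xr mulgA x'x mul1g.
  - rewrite !big_cons !big_nil mulg1 /f /=; case: ifP => _ //.
    by rewrite -mulgA rK.
  - rewrite !big_cons !big_nil mulg1 /f /=; case: ifP => _ //.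
    by rewrite -mulgA xK.
exists F; split=> //; first by rewrite /D_sigma FE.
by rewrite /D_rho Fm.2 !FE /f /= xK.
Qed.

Lemma dihedral_lift_group (H : groupType) (x r : H) :
  commute x (r ^+ (n + 2)) ->
  exists F : D -> H, [/\ monoid_morphism F, F D_sigma = x & F D_rho = r].
Proof. by apply: (@dihedral_lift H x x^-1 r r^-1); rewrite ?mulgV ?mulVg. Qed.

Lemma eq_dihedral_morphism (H : groupType) (f g : D -> H) :
  monoid_morphism f -> monoid_morphism g ->
  f D_sigma = g D_sigma -> f D_rho = g D_rho -> f =1 g.
Proof.
move=> fm gm fgs fgr; apply: eq_presented_group_morphism => // -[[|[|//]] i2].
  by move: fgs; congr (f (group_generator _ _) = g (group_generator _ _));
    exact: val_inj.
have : f (D_sigma^-1 * D_rho) = g (D_sigma^-1 * D_rho).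
  by rewrite fm gm !morphismV // fgs fgr.
rewrite -D_tauE.
by congr (f (group_generator _ _) = g (group_generator _ _));
    exact: val_inj.
Qed.

(* [tau2] solved from [tau1 * rho * tau2 = rho ^ 2]. *)
Definition group_tau (H : groupType) (x r : H) (s : bool) : H :=
  if s then x else r^-1 * x^-1 * r ^+ 2.

Lemma group_tau_rel (H : groupType) (x r : H) :
  commute x (r ^+ (n + 2)) ->
  forall s, group_tau x r s * r ^+ gap n s * group_tau x r (~~ s) = r ^+ (gap n s).+1.
Proof.
move=> xr [] /=; first by rewrite -!mulgA mulVKg mulVKg.
have -> : r^-1 * x^-1 * r ^+ 2 * r ^+ n * x = r^-1 * (x^-1 * (r ^+ (n + 2) * x)).
  by rewrite addnC expgnDr !mulgA.
by rewrite -xr mulKg addn2 expgS mulKg.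
Qed.

Lemma morphism_group_tau (G H : groupType) (f : G -> H) x r s :
  monoid_morphism f -> f (group_tau x r s) = group_tau (f x) (f r) s.
Proof. by move=> fm; case: s => //=; rewrite !fm.2 !(morphismV _ fm). Qed.

Lemma M_morphism_tauE (H : groupType) (i : M_ n -> H) s :
  monoid_morphism i -> i (M_tau n s) = group_tau (i (M_tau n true)) (i (M_rho n)) s.
Proof.
move=> im; case: s => //=; rewrite -(morphismX _ _ im) -(M_tau_rel n true).
by rewrite !im.2 expg1 -!mulgA mulKg mulKg.
Qed.

Fact M_to_D_exists : exists j : M_ n -> D,
  [/\ monoid_morphism j, forall s, j (M_tau n s) = group_tau D_sigma D_rho s
    & j (M_rho n) = D_rho].
Proof. exact/M_lift/group_tau_rel/D_commute. Qed.

Definition M_to_D : M_ n -> D := sval (cid M_to_D_exists).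

Lemma M_to_D_morphism : monoid_morphism M_to_D.
Proof. by rewrite /M_to_D; case: cid => j []. Qed.

Lemma M_to_D_tau s : M_to_D (M_tau n s) = group_tau D_sigma D_rho s.
Proof. by rewrite /M_to_D; case: cid => j []. Qed.

Lemma M_to_D_rho : M_to_D (M_rho n) = D_rho.
Proof. by rewrite /M_to_D; case: cid => j []. Qed.

(** * Extension of the action to the Artin group, and the embedding *)

Definition nf_rhoV : endo (normal_form n) :=
  fun y => Sub ((val y).1 - 1%:Z, (val y).2)%R (valP y).

Lemma nf_rhoK : nf_rhoV * @nf_rho n = 1.
Proof.
apply/funext => -[[a l] rl]; apply: val_inj => /=.
by rewrite GRing.addrK.
Qed.

Lemma nf_rhoVK : @nf_rho n * nf_rhoV = 1.
Proof.
apply/funext => -[[a l] rl]; apply: val_inj => /=.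
by rewrite GRing.subrK.
Qed.

(** The inverse of [tau1] read off from [tau1 rho tau2 = rho^2]. *)
Definition nf_tauV : endo (normal_form n) :=
  @nf_rho n * nf_tau false * nf_rhoV ^+ 2.

Lemma nf_tauVK : nf_tau true * nf_tauV = 1 :> endo (normal_form n).
Proof.
rewrite /nf_tauV !mulgA (@nf_tau_rel n true).
exact: expg_right_inverse nf_rhoVK nf_rhoK.
Qed.

Lemma nf_commute : commute (@nf_tau n true) (@nf_rho n ^+ (n + 2)).
Proof.
have /(congr1 (@M_act n)) := commute_sym (M_Delta_central (M_tau n true)).
rewrite !(M_act_morphism n).2.
by rewrite (morphismX _ _ (M_act_morphism n)) M_act_tau M_act_rho.
Qed.

Lemma nf_tauK : nf_tauV * nf_tau true = 1 :> endo (normal_form n).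
Proof.
exact: left_inverse_of_rel nf_rhoVK nf_rhoK nf_commute (@nf_tau_rel n false).
Qed.

(** The faithful action of the monoid on normal forms factors through this map. *)
Lemma M_to_D_inj : injective M_to_D.
Proof.
have [F [Fm Fs Fr]] :=
  dihedral_lift nf_tauVK nf_tauK nf_rhoVK nf_rhoK nf_commute.
suff FE : F \o M_to_D =1 @M_act n.
  by move=> a b ab; apply: M_act_inj; rewrite -!FE /= ab.
apply: eq_M_morphism; last 1 first.
- by rewrite /= M_to_D_rho Fr M_act_rho.
- split=> [|a b] /=; first by rewrite M_to_D_morphism Fm.
  by rewrite M_to_D_morphism Fm.
- exact: M_act_morphism.
case=> /=; rewrite M_to_D_tau M_act_tau //.
(* The image of [tau2] is identified by cancelling in the first relation, using left inverses
   only. *)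
have : F (D_sigma * D_rho * group_tau D_sigma D_rho false) =
       nf_tau true * @nf_rho n * nf_tau false.
  rewrite (@nf_tau_rel n true) -Fr -(morphismX _ _ Fm).
  by rewrite (group_tau_rel D_commute true).
rewrite [LHS]Fm.2 [X in X * _]Fm.2 Fs Fr.
exact: left_inverse_cancel nf_tauK nf_rhoK.
Qed.

(** Fractions over powers of the central [Delta] are closed under products, and they contain the
    inverse of every monoid element because it divides such a power. *)
Lemma M_to_D_fraction (g : D) :
  exists a k, g = M_to_D a * (M_to_D (M_Delta n) ^+ k)^-1.
Proof.
have [j1 jM] := M_to_D_morphism; have jX := morphismX _ _ M_to_D_morphism.
pose P (h : D) := exists a k, h = M_to_D a * (M_to_D (M_Delta n) ^+ k)^-1.
have Pj a : P (M_to_D a) by exists a, 0%N; rewrite invg1 mulg1.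
have PV a : P (M_to_D a)^-1.
  have [b [k abD]] := M_Delta_multiple a; exists b, k.
  by rewrite -jX -abD jM invgM mulVKg.
have PM h h' : P h -> P h' -> P (h * h').
  move=> [a [k ->]] [b [l ->]]; exists (a * b), (k + l)%N.
  rewrite addnC jM expgnDr invgM !mulgA; congr (_ * _); rewrite -!mulgA; congr (_ * _).
  apply/esym/commuteV; rewrite /commute -jX -!jM.
  by rewrite (expD_central (@M_Delta_central n)).
have Ps : P D_sigma by have := Pj (M_tau n true); rewrite M_to_D_tau.
have PsV : P D_sigma^-1 by have := PV (M_tau n true); rewrite M_to_D_tau.
have Pr : P D_rho by have := Pj (M_rho n); rewrite M_to_D_rho.
have PrV : P D_rho^-1 by have := PV (M_rho n); rewrite M_to_D_rho.
rewrite -/(P g); elim/presented_ind: g => [|[i e] g]; first by rewrite -j1; exact: Pj.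
move=> Pg; apply: (PM _ _ _ Pg); case: e; last rewrite generator_inverse.
  case: i => [[|[|//]] i2].
    by move: Ps; congr (P (group_generator _ _)); exact: val_inj.
  have := PM _ _ PsV Pr; rewrite -D_tauE.
  by congr (P (group_generator _ _)); exact: val_inj.
case: i => [[|[|//]] i2].
  by move: PsV; congr (P (group_generator _ _)^-1); exact: val_inj.
have := PM _ _ PrV Ps; rewrite -[D_sigma]invgK -invgM -D_tauE.
by congr (P (group_generator _ _)^-1); exact: val_inj.
Qed.

Lemma M_to_D_group_of_fractions : group_of_fractions M_to_D.
Proof.
have jm := M_to_D_morphism; split; [exact: jm|exact: M_to_D_inj| |] => g; last first.
  have [a [k ->]] := M_to_D_fraction g.
  by exists a, (M_Delta n ^+ k); rewrite (morphismX _ _ jm).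
have [a [k ->]] := M_to_D_fraction g.
exists (M_Delta n ^+ k), a; rewrite -(morphismX _ _ jm).
apply/commuteV; rewrite /commute -!jm.2.
by rewrite (expD_central (@M_Delta_central n)).
Qed.

Lemma group_of_fractions_isomorphic (G : groupType) (i : M_ n -> G) :
  group_of_fractions i -> isomorphic_groups G (dihedral_artin_group n).
Proof.
move=> [im i_inj fracl _]; apply: isomorphic_groups_sym.
have [|f [fm fs fr]] := @dihedral_lift_group G (i (M_tau n true)) (i (M_rho n)).
  rewrite /commute -(morphismX _ _ im) -!im.2; congr i; exact/esym/M_Delta_central.
have fj : f \o M_to_D =1 i.
  apply: eq_M_morphism => //=.
  - by split=> [|a b] /=; rewrite M_to_D_morphism fm.
  - move=> s; rewrite M_to_D_tau (M_morphism_tauE s im) -fs -fr.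
    exact: morphism_group_tau.
  - by rewrite M_to_D_rho fr.
apply: (bijective_morphism_isomorphic fm) => [g h|g].
  move=> fgh; have [_ _ fracD _] := M_to_D_group_of_fractions.
  (* A kernel element written as [a^-1 b] gives [i a = i b], hence [a = b]. *)
  have [a [b gE]] := fracD (g * h^-1).
  have := fm.2 g h^-1; rewrite gE fm.2 !(morphismV _ fm) -fgh mulgV.
  rewrite -/((f \o M_to_D) a) -/((f \o M_to_D) b) !fj => /mulg1_eq.
  by rewrite invgK => /i_inj ab; apply: divg1_eq; rewrite gE ab mulVg.
have [a [b ->]] := fracl g; exists ((M_to_D a)^-1 * M_to_D b).
by rewrite fm.2 (morphismV _ fm) -!fj.
Qed.

End DihedralArtinGroup.

(** * The braid group of [G_13] *)

Section BraidGroupG13.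
Let B := braid_group_G13.
Let D := dihedral_artin_group 1.

Definition B_gen (i : 'I_3) : B := group_generator braid_G13_relation i.

Definition B_delta : B := B_gen x1 * B_gen x2 * B_gen x3.

Lemma B_delta_conj : B_gen x3 * B_delta = B_delta * B_gen x1.
Proof.
have := group_generator_relation BraidG13Rel2.
by rewrite !big_cons !big_nil !mulg1 /B_delta !mulgA.
Qed.

Lemma B_x2E : B_gen x2 = (B_gen x1)^-1 * B_delta * (B_gen x3)^-1.
Proof. by rewrite /B_delta -!mulgA mulKg mulgV mulg1. Qed.

Lemma B_commute : commute (B_gen x1) (B_delta ^+ 3).
Proof.
have xdd : B_gen x1 * B_delta * B_delta = B_delta * B_delta * B_gen x3.
  have := group_generator_relation BraidG13Rel1.
  rewrite !big_cons !big_nil !mulg1 -!/(B_gen _).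
  (* Bordering the first relation by [x1] and [x3] completes both sides to words in
     [delta = x1 x2 x3]. *)
  move/(congr1 (fun z => B_gen x1 * z * B_gen x3)).
  by rewrite /B_delta !mulgA.
have cube (x d z : B) : x * d * d = d * d * z -> z * d = d * x -> commute x (d ^+ 3).
  by move=> xd zd; rewrite /commute !expgS expg0 mulg1 !mulgA xd -[LHS]mulgA zd !mulgA.
exact: cube xdd B_delta_conj.
Qed.

Lemma braid_G13_lift (H : groupType) (x r : H) :
  commute x (r ^+ 3) ->
  exists F : B -> H, [/\ monoid_morphism F, F (B_gen x1) = x,
    F (B_gen x3) = r * x * r^-1 & F B_delta = r].
Proof.
move=> xr; pose y3 := r * x * r^-1; pose y2 := x^-1 * r * y3^-1.
have y123 : x * y2 * y3 = r.
  have cancel z : x * (x^-1 * r * z^-1) * z = r by rewrite -!mulgA mulVg mulg1 mulVKg.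
  exact: cancel.
have y3r : y3 * r = r * x by rewrite /y3 mulgVK.
have y3E : y3 = r * x * r^-1 by [].
clearbody y2 y3; pose f (i : 'I_3) := if i == x1 then x else if i == x2 then y2 else y3.
(* Converse of the computation in [B_commute]: centrality gives [z1 d d = d d z3], and the bordering
   letters cancel. *)
have rel1 (z1 z2 z3 d : H) : z1 * z2 * z3 = d -> z3 * d = d * z1 ->
    commute z1 (d ^+ 3) -> z1 * z2 * z3 * z1 * z2 = z2 * z3 * z1 * z2 * z3.
  move=> dE z3d.
  rewrite /commute !expgS expg0 mulg1 => z1d.
  have : z1 * d * d = d * d * z3.
    by apply: (mulIg d); rewrite -[RHS]mulgA z3d -!mulgA z1d !mulgA.
  rewrite -dE => dd; apply: (mulgI z1); apply: (mulIg z3).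
  by move: dd; rewrite !mulgA.
have [|F [Fm FE]] := @presented_group_lift _ braid_G13_relation H f.
  move=> _ _ []; rewrite !big_cons !big_nil !mulg1 /f /= !mulgA; last first.
    by rewrite y123 -y3r -y123 !mulgA.
  exact: rel1 y123 y3r xr.
exists F; split=> //; rewrite ?FE //.
by rewrite /B_delta !Fm.2 !FE.
Qed.

(** The inverse maps match [sigma] with [x1] and [rho] with [delta]; [x2] is then determined by
    [x1], [x3] and [delta]. *)
Lemma dihedral_isomorphic_G13 : isomorphic_groups D B.
Proof.
have [f [fm fs fr]] := dihedral_lift_group (n := 1) B_commute.
have [g [gm g1 g3 gr]] := braid_G13_lift (@D_commute 1).
exists f; split=> //; exists g.
  apply: eq_dihedral_morphism => //=.
  - by split=> [|a b] /=; rewrite fm gm.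
  - by rewrite fs g1.
  - by rewrite fr gr.
have fg1 : f (g (B_gen x1)) = B_gen x1 by rewrite g1 fs.
have fg3 : f (g (B_gen x3)) = B_gen x3.
  by rewrite g3 2!fm.2 (morphismV _ fm) fs fr -B_delta_conj mulgK.
apply: (@eq_presented_group_morphism _ _ B (f \o g) id) => //=.
  by split=> [|a b] /=; rewrite gm fm.
move=> i; have : i \in [:: x1; x2; x3] by case: i => [[|[|[|//]]] i3].
rewrite !inE => /or3P[] /eqP -> //.
rewrite -/(B_gen x2) B_x2E 2!gm.2 !(morphismV _ gm) gr 2!fm.2 !(morphismV _ fm).
by rewrite fg1 fg3 fr.
Qed.

End BraidGroupG13.

(** Cancellation is inherited from the Artin group, and the additive length witnesses
    Noetherianity. *)
Lemma M_garside (n : nat) : garside_monoid (M_Delta n).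
Proof.
have [jm j_inj _ _] := M_to_D_group_of_fractions n.
have mulMI (a b c : M_ n) : a * b = a * c -> b = c.
  by move/(congr1 (@M_to_D n)); rewrite !jm.2 => /mulgI/j_inj.
have mulIM (a b c : M_ n) : b * a = c * a -> b = c.
  by move/(congr1 (@M_to_D n)); rewrite !jm.2 => /mulIg/j_inj.
have Dc := @M_Delta_central n; have Dm := @M_Delta_multiple n.
have gcd : forall a b : M_ n, exists d, is_left_gcd a b d.
  apply: (left_gcd_exists (t := @M_tau n) (r := M_rho n) (gap := gap n)
    mulMI (@M_lenM n)).
  - by move=> s; rewrite M_len_tau.
  - by rewrite M_len_rho.
  - exact: M_tau_rel.
  - exact: M_atomP.
  - exact: rho_divides_tau.
  - exact: tau_divides_tau.
split=> //.
- exists (@M_len n); split=> [a b|a a1 /M_len_eq0 //]; by rewrite M_lenM.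
- exact: (right_lcm (@M_lenM n) (@M_len_eq0 n) Dm gcd).
- exact: (left_lcm mulMI mulIM (@M_lenM n) (@M_len_eq0 n) Dc Dm gcd).
- exact: (right_gcd mulMI mulIM (@M_lenM n) (@M_len_eq0 n) Dc Dm gcd).
- by have := central_divisors mulMI Dc 1; rewrite expg1.
- exact: M_generates.
- exact: M_finite_divisors.
Qed.

Local Close Scope group_scope.

Theorem proposition7p6 (n : nat) (hn : 1 <= n) :
  [/\ garside_monoid (M_Delta n),
      forall x : M_ n, commute (M_Delta n) x,
      exists (G : groupType) (i : M_ n -> G), group_of_fractions i,
      forall (G : groupType) (i : M_ n -> G),
        group_of_fractions i -> isomorphic_groups G (dihedral_artin_group n) &
      n = 1 -> isomorphic_groups (dihedral_artin_group n) braid_group_G13].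
Proof.
split.
- exact: M_garside.
- exact: M_Delta_central.
- by exists (dihedral_artin_group n), (@M_to_D n); exact: M_to_D_group_of_fractions.
- exact: group_of_fractions_isomorphic.
- by move=> ->; exact: dihedral_isomorphic_G13.
Qed.
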